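(* Let $f:\mathbb{R}^n\to\mathbb{R}^n$ be a piecewise-affine function with abs-normal form data $s,c,b,Z,L,J,Y$ (with $m=n$), let $\tilde L,\tilde Y,\tilde Z,\tilde J$ be the associated auxiliary matrices, and suppose that $\tilde J$ is nonsingular. Let $\check S:=\tilde L-\tilde Z\tilde J^{-1}\tilde Y\in\mathbb{R}^{s\times s}$. If $\check S$ is a Q-matrix, then there exists $x\in\mathbb{R}^n$ for which $f(x)=0$. If $\check S$ is a P-matrix, then there is exactly one such $x$.
   Context: A function $f:\mathbb{R}^n\to\mathbb{R}^m$ is piecewise affine if it is continuous and its values are chosen from finitely many affine functions, i.e. there are finitely many affine maps $f^1,\dots,f^k$ with $f(x)\in\{f^1(x),\dots,f^k(x)\}$ for every $x$. For a vector $z$, $|z|$ denotes the componentwise absolute value; vector inequalities are componentwise. For vectors $p,q$ of the same size, $0\le p\perp q\ge 0$ means $p\ge0$, $q\ge0$ and $p^{T}q=0$. Abs-normal form: $f$ has abs-normal form data consisting of $s\in\mathbb{N}$, matrices $Z\in\mathbb{R}^{s\times n}$, $J\in\mathbb{R}^{m\times n}$, $Y\in\mathbb{R}^{m\times s}$, a strictly lower triangular matrix $L\in\mathbb{R}^{s\times s}$, and vectors $c\in\mathbb{R}^s$, $b\in\mathbb{R}^m$, if for every $x\in\mathbb{R}^n$ the unique vector $z\in\mathbb{R}^s$ with $z=c+Zx+L|z|$ satisfies $f(x)=b+Jx+Y|z|$. Here $m=n$. Auxiliary quantities: $\tilde L:=(I-L)^{-1}(I+L)$, $\tilde Y:=Y(I+\tilde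 L)$, $\tilde Z:=(I-L)^{-1}Z$, $\tilde J:=J+Y\tilde Z$. ($I-L$ is unit lower triangular, hence invertible.) A real square matrix $M\in\mathbb{R}^{s\times s}$ is a Q-matrix if for every $q\in\mathbb{R}^s$ the linear complementarity problem $0\le w\perp q+Mw\ge 0$ has a solution $w\in\mathbb{R}^s$. It is a P-matrix if all its principal minors are positive (equivalently, if that problem has exactly one solution for every $q\in\mathbb{R}^s$). *)

(* Defs.v *)
From mathcomp Require Import all_boot all_order all_algebra.
From mathcomp Require Import all_classical all_reals all_analysis.
Import Order.TTheory GRing.Theory Num.Theory numFieldNormedType.Exports.

Set Implicit Arguments.
Unset Strict Implicit.
Unset Printing Implicit Defensive.

Local Open Scope ring_scope.

(* [continuous] refers to the product topology on ['cV[R]_n], i.e. the usual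
   topology of R^n. *)
Definition piecewise_affine (R : realType) (n m : nat)
    (f : 'cV[R]_n -> 'cV[R]_m) : Prop :=
  continuous f /\
  exists (k : nat) (A : 'I_k -> 'M[R]_(m, n)) (d : 'I_k -> 'cV[R]_m),
    forall x, exists i, f x = A i *m x + d i.

(* Not the norm [`|z|] of MathComp-Analysis, which is the scalar sup norm. *)
Definition abs_vec (R : realType) (s : nat) (z : 'cV[R]_s) : 'cV[R]_s :=
  map_mx Num.norm z.

Definition nonneg_vec (R : realType) (s : nat) (p : 'cV[R]_s) : Prop :=
  forall i, 0 <= p i 0.

(* The product [p^T *m q] is a 1 x 1 matrix. *)
Definition complementary (R : realType) (s : nat) (p q : 'cV[R]_s) : Prop :=
  [/\ nonneg_vec p, nonneg_vec q & p^T *m q = 0].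

(* [is_trig_mx] of the library allows a nonzero diagonal. *)
Definition strictly_lower_triangular (R : realType) (s : nat)
    (L : 'M[R]_s) : Prop :=
  forall i j : 'I_s, (i <= j)%N -> L i j = 0.

Definition switching_eq (R : realType) (n s : nat) (c : 'cV[R]_s)
    (Z : 'M[R]_(s, n)) (L : 'M[R]_s) (x : 'cV[R]_n) (z : 'cV[R]_s) : Prop :=
  z = c + Z *m x + L *m abs_vec z.

Lemma switching_vec_unique (R : realType) (n s : nat) (c : 'cV[R]_s)
    (Z : 'M[R]_(s, n)) (L : 'M[R]_s) (x : 'cV[R]_n) :
  strictly_lower_triangular L -> exists! z, switching_eq c Z L x z.
Proof.
move=> Llow; rewrite /switching_eq; set a := c + Z *m x.
have dep k (z w : 'cV[R]_s) : (forall j : 'I_s, (j < k)%N -> z j 0 = w j 0) ->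
    forall i : 'I_s, (i <= k)%N ->
    (a + L *m abs_vec z) i 0 = (a + L *m abs_vec w) i 0.
  move=> zw i ik; rewrite mxE [RHS]mxE; congr (_ + _).
  rewrite mxE [RHS]mxE; apply: eq_bigr => j _; rewrite !mxE.
  have [ij|ji] := leqP i j; first by rewrite Llow // !mul0r.
  by rewrite zw // (leq_trans ji).
pose g (z : 'cV[R]_s) := a + L *m abs_vec z.
have eq_lt (z w : 'cV[R]_s) k : z = g z -> w = g w ->
    forall i : 'I_s, (i < k)%N -> z i 0 = w i 0.
  move=> zE wE; elim: k => // k IH i; rewrite ltnS => ik.
  by rewrite zE wE; apply: (dep k).
have iterE k : forall i : 'I_s, (i < k)%N ->
    iter k g 0 i 0 = iter k.+1 g 0 i 0.
  elim: k => // k IH i; rewrite ltnS => ik.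
  exact: (dep k (iter k g 0) (iter k.+1 g 0)).
exists (iter s g 0); split.
  by apply/colP => i; rewrite (iterE s i (ltn_ord i)).
move=> w wE; apply/colP => i; apply: (eq_lt _ _ s) => //.
by apply/colP => j; rewrite (iterE s j (ltn_ord j)).
Qed.

(* By [switching_vec_unique] there is exactly one [z] to which the last
   condition applies, for each [x]. *)
Definition abs_normal_form (R : realType) (n m s : nat)
    (f : 'cV[R]_n -> 'cV[R]_m) (c : 'cV[R]_s) (b : 'cV[R]_m)
    (Z : 'M[R]_(s, n)) (L : 'M[R]_s) (J : 'M[R]_(m, n))
    (Y : 'M[R]_(m, s)) : Prop :=
  strictly_lower_triangular L /\
  forall x z, switching_eq c Z L x z -> f x = b + J *m x + Y *m abs_vec z.

Definition tildeL (R : realType) (s : nat) (L : 'M[R]_s) : 'M[R]_s :=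
  invmx (1%:M - L) *m (1%:M + L).

Definition tildeY (R : realType) (m s : nat) (L : 'M[R]_s)
    (Y : 'M[R]_(m, s)) : 'M[R]_(m, s) :=
  Y *m (1%:M + tildeL L).

Definition tildeZ (R : realType) (n s : nat) (L : 'M[R]_s)
    (Z : 'M[R]_(s, n)) : 'M[R]_(s, n) :=
  invmx (1%:M - L) *m Z.

Definition tildeJ (R : realType) (n m s : nat) (Z : 'M[R]_(s, n))
    (L : 'M[R]_s) (J : 'M[R]_(m, n)) (Y : 'M[R]_(m, s)) : 'M[R]_(m, n) :=
  J + Y *m tildeZ L Z.

Definition checkS (R : realType) (n s : nat) (Z : 'M[R]_(s, n))
    (L : 'M[R]_s) (J : 'M[R]_n) (Y : 'M[R]_(n, s)) : 'M[R]_s :=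
  tildeL L - tildeZ L Z *m invmx (tildeJ Z L J Y) *m tildeY L Y.

Definition Q_matrix (R : realType) (s : nat) (M : 'M[R]_s) : Prop :=
  forall q : 'cV[R]_s, exists w : 'cV[R]_s, complementary w (q + M *m w).

Definition principal_submx (R : realType) (s : nat) (M : 'M[R]_s)
    (A : {set 'I_s}) : 'M[R]_#|A| :=
  mxsub enum_val enum_val M.

(* The empty set contributes the harmless condition [0 < 1]. *)
Definition P_matrix (R : realType) (s : nat) (M : 'M[R]_s) : Prop :=
  forall A : {set 'I_s}, 0 < \det (principal_submx M A).

(* Main.v *)
(* Write z = u - w with u, w the positive and negative parts of z, so that
   |z| = u + w.  The switching equation becomes u = c~ + Z~ x + L~ w and
   f x = b~ + J~ x + Y~ w; eliminating x from f x = 0 leaves the linear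
   complementarity problem 0 <= w, 0 <= u = q + S w, w^T u = 0.

   For a P-matrix M, multilinearity in the rows expands
   det (diag a *m M + diag b), with a, b nonnegative and never both zero, into
   a nonnegative combination of principal minors, so it is positive.  Hence
   d_i (M d)_i <= 0 for all i forces d = 0, which gives uniqueness.  Existence
   is the argument behind Murty's least-index method: solve the problem with
   w_k forced to 0; if this makes y_k negative, then in the solution with y_k
   forced to 0 one has w_k > 0, because d_k (M d)_k must be positive for the
   difference d of the two. *)
Require Import Defs.
From mathcomp Require Import all_boot all_order all_fingroup all_algebra.
From mathcomp Require Import all_classical all_reals all_analysis.
From mathcomp Require Import ring lra.
Import Order.TTheory GRing.Theory Num.Theory numFieldNormedType.Exports.

Set Implicit Arguments.
Unset Strict Implicit.

Local Open Scope ring_scope.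

(** * Determinants and sign reversal for P-matrices *)

Lemma det_mxsub_inj (R : comNzRingType) (m n : nat) (h : 'I_m -> 'I_n)
    (N : 'M[R]_n) :
  m = n -> injective h -> \det (mxsub h h N) = \det N.
Proof.
move=> mn; case: n / mn h N => h N hinj.
have -> : mxsub h h N = row_perm (perm hinj) (col_perm (perm hinj) N).
  by apply/matrixP => i j; rewrite !mxE !permE.
(* The same permutation acts on rows and columns, so its sign occurs twice and cancels. *)
rewrite row_permE col_permE !det_mulmx !det_perm odd_permV.
by rewrite mulrCA -signr_addb addbb mulr1.
Qed.

(** Listing the indices of [A] first makes [N] block upper triangular: the unit rows outside [A]
    yield a zero block and an identity block. *)
Lemma det_principal_submx (R : realType) (s : nat) (N : 'M[R]_s)
    (A : {set 'I_s}) :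
  (forall i j, i \notin A -> N i j = (i == j)%:R) ->
  \det N = \det (principal_submx N A).
Proof.
move=> NA.
pose h (i : 'I_(#|A| + #|~: A|)) : 'I_s :=
  match fintype.split i with inl j => enum_val j | inr j => enum_val j end.
have hl j : h (lshift _ j) = enum_val j by rewrite /h (unsplitK (inl j)).
have hr j : h (rshift _ j) = enum_val j by rewrite /h (unsplitK (inr j)).
have hrA j : h (rshift _ j) \notin A.
  by rewrite hr; have := enum_valP j; rewrite inE.
have hlA j : h (lshift _ j) \in A by rewrite hl; exact: enum_valP.
have hinj : injective h.
  move=> i j; case: (splitP i) => a ia; case: (splitP j) => d jd.
  - have -> : i = lshift _ a by apply/val_inj.
    have -> : j = lshift _ d by apply/val_inj.
    by rewrite !hl => /enum_val_inj ->.
  - have -> : i = lshift _ a by apply/val_inj.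
    have -> : j = rshift _ d by apply/val_inj.
    by move=> e; have := hrA d; rewrite -e hlA.
  - have -> : i = rshift _ a by apply/val_inj.
    have -> : j = lshift _ d by apply/val_inj.
    by move=> e; have := hrA a; rewrite e hlA.
  - have -> : i = rshift _ a by apply/val_inj.
    have -> : j = rshift _ d by apply/val_inj.
    by rewrite !hr => /enum_val_inj ->.
have card : (#|A| + #|~: A|)%N = s by rewrite cardsC card_ord.
rewrite -(@det_mxsub_inj _ _ _ h N card hinj) -[mxsub _ _ _]submxK.
have -> : dlsubmx (mxsub h h N) = 0.
  apply/matrixP => i j; rewrite !mxE NA //.
  by case: eqP => // e; have := hrA i; rewrite e hlA.
have -> : drsubmx (mxsub h h N) = 1%:M.
  apply/matrixP => i j; rewrite !mxE NA // (inj_eq hinj).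
  by rewrite (inj_eq (@rshift_inj _ _)).
rewrite det_ublock det1 mulr1; congr (\det _).
by apply/matrixP => i j; rewrite !mxE !hl.
Qed.

(** This is [diag a *m M + diag b]; written entrywise, it shows that [a i] and [b i] affect row [i]
    only. *)
Definition row_mix (R : realType) (s : nat) (M : 'M[R]_s) (a b : 'I_s -> R) :
    'M[R]_s :=
  \matrix_(i, j) (a i * M i j + b i * (i == j)%:R).

Lemma row_mix_mul (R : realType) (s : nat) (M : 'M[R]_s) (a b : 'I_s -> R)
    (d : 'cV[R]_s) i :
  (row_mix M a b *m d) i 0 = a i * (M *m d) i 0 + b i * d i 0.
Proof.
rewrite [LHS]mxE [X in a i * X]mxE mulr_sumr.
under eq_bigr => j _ do rewrite mxE mulrDl -!mulrA.
rewrite big_split /=; congr (_ + _).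
rewrite (bigD1 i) //= eqxx mul1r big1 ?addr0 // => j ji.
by rewrite eq_sym (negPf ji) mul0r mulr0.
Qed.

Lemma P_matrix_det_row_mix (R : realType) (s : nat) (M : 'M[R]_s)
    (a b : 'I_s -> R) :
  P_matrix M -> (forall i, 0 <= a i) -> (forall i, 0 <= b i) ->
  (forall i, 0 < a i + b i) -> 0 < \det (row_mix M a b).
Proof.
move=> MP.
(* A pure row is a row of [M] or a unit row. The induction is on the number of other rows; once all
   are pure, the determinant is a principal minor of [M]. *)
pose pure (a b : 'I_s -> R) i :=
  ((a i == 1) && (b i == 0)) || ((a i == 0) && (b i == 1)).
have [m] := ubnP #|[set i | ~~ pure a b i]|.
elim: m a b => // m IH a b; rewrite ltnS => le_m a0 b0 ab0.
have [k kimp|allp] := pickP (fun i => ~~ pure a b i); last first.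
  pose A := [set i | a i == 1].
  have pureP i : pure a b i by have := allp i => /negbFE.
  rewrite (@det_principal_submx _ _ _ A).
    suff -> : principal_submx (row_mix M a b) A = principal_submx M A by [].
    apply/matrixP => i j; rewrite !mxE.
    have := enum_valP i; rewrite inE => /eqP ai.
    have := pureP (enum_val i); rewrite /pure ai eqxx oner_eq0 /= orbF.
    by move=> /eqP ->; rewrite mul1r mul0r addr0.
  move=> i j; rewrite inE mxE => ai.
  have := pureP i; rewrite /pure (negPf ai) /= => /andP[/eqP-> /eqP->].
  by rewrite mul0r mul1r add0r.
pose upd (x : R) (g : 'I_s -> R) i := if i == k then x else g i.
have less x y : ((x == 1) && (y == 0)) || ((x == 0) && (y == 1)) ->
    (#|[set i | ~~ pure (upd x a) (upd y b) i]| < m)%N.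
  move=> xy; apply: leq_trans le_m; apply: proper_card.
  apply/properP; split.
    apply/fintype.subsetP => i; rewrite !inE /pure /upd.
    by case: (i =P k) => [_|//]; rewrite xy.
  by exists k; rewrite !inE // /pure /upd eqxx xy.
have upd0 x g : 0 <= x -> (forall i, 0 <= g i) -> forall i, 0 <= upd x g i.
  by move=> x0 g0 i; rewrite /upd; case: (i =P k).
have updD x y : 0 < x + y -> forall i, 0 < upd x a i + upd y b i.
  by move=> xy i; rewrite /upd; case: (i =P k).
have D1 : 0 < \det (row_mix M (upd 1 a) (upd 0 b)).
  apply: IH; first by apply: less; rewrite !eqxx.
  - exact: upd0.
  - exact: upd0.
  - by apply: updD; rewrite addr0.
have D2 : 0 < \det (row_mix M (upd 0 a) (upd 1 b)).
  apply: IH; first by apply: less; rewrite !eqxx orbT.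
  - exact: upd0.
  - exact: upd0.
  - by apply: updD; rewrite add0r.
(* Linearity in row [k] splits the determinant into [a k] times the first one plus [b k] times the
   second. *)
rewrite (@determinant_multilinear _ _ _ (row_mix M (upd 1 a) (upd 0 b))
  (row_mix M (upd 0 a) (upd 1 b)) k (a k) (b k)); first last.
- apply/matrixP => i j; rewrite !mxE /upd.
  by rewrite eq_sym (negPf (neq_lift _ _)).
- apply/matrixP => i j; rewrite !mxE /upd.
  by rewrite eq_sym (negPf (neq_lift _ _)).
- by apply/rowP => j; rewrite !mxE /upd !eqxx; ring.
have := ab0 k; have := a0 k; rewrite le0r => /orP[/eqP->|ak _].
  by rewrite mul0r !add0r => bk; rewrite mulr_gt0.
by rewrite ltr_wpDr ?mulr_gt0 // mulr_ge0 // ltW.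
Qed.

Lemma P_matrix_sign_reversal (R : realType) (s : nat) (M : 'M[R]_s)
    (d : 'cV[R]_s) :
  P_matrix M -> (forall i, d i 0 * (M *m d) i 0 <= 0) -> d = 0.
Proof.
move=> MP dM; pose y := M *m d.
pose z i := (d i 0 == 0) && (y i 0 == 0).
(* As [d i 0] and [y i 0] never have the same strict sign, these weights give
   [a i * y i 0 + b i * d i 0 = 0], so [d] lies in the kernel of an invertible matrix. The value 1
   keeps [a i + b i] positive where both entries vanish. *)
pose a i : R := if z i then 1 else `|d i 0|.
pose b i : R := if z i then 1 else `|y i 0|.
have G0 : 0 < \det (row_mix M a b).
  apply: P_matrix_det_row_mix => // i; rewrite /a /b; case: ifPn => //.
  by rewrite /z negb_and -!normr_gt0 => /orP[]; have := normr_ge0 (d i 0);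
    have := normr_ge0 (y i 0); lra.
have Gu : row_mix M a b \in unitmx by rewrite unitmxE unitfE gt_eqF.
rewrite -(mulKmx Gu d); suff -> : row_mix M a b *m d = 0 by rewrite mulmx0.
apply/colP => i; rewrite row_mix_mul [RHS]mxE -/y /a /b.
case: ifPn => [/andP[/eqP-> /eqP->]|_]; first by rewrite !mulr0 addr0.
have := dM i; rewrite -/y.
case: (ger0P (d i 0)) => d0; case: (ger0P (y i 0)) => y0 H; nra.
Qed.

(** * Linear complementarity problems with a P-matrix *)

Lemma complementaryP (R : realType) (s : nat) (p q : 'cV[R]_s) :
  complementary p q <->
  forall i, [/\ 0 <= p i 0, 0 <= q i 0 & p i 0 * q i 0 = 0].
Proof.
split=> [[p0 q0 pq] i|H].
  split=> //; move/matrixP: pq => /(_ 0 0); rewrite !mxE => /eqP.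
  under eq_bigr => j _ do rewrite mxE.
  rewrite psumr_eq0 => [|j _]; last exact: mulr_ge0.
  by move=> /allP /(_ i); rewrite mem_index_enum => /(_ isT) /eqP.
split=> [i|i|]; [by have [] := H i|by have [] := H i|].
apply/matrixP => i j; rewrite !ord1 !mxE big1 // => k _.
by rewrite mxE; have [] := H k.
Qed.

(** With slacks [y], [y'], the product of [w - w'] and [y - y'] at [i] is
    [- w i * y' i - w' i * y i], hence nonpositive, and sign reversal applies. *)
Lemma P_matrix_lcp_unique (R : realType) (s : nat) (M : 'M[R]_s)
    (q w w' : 'cV[R]_s) :
  P_matrix M -> complementary w (q + M *m w) ->
  complementary w' (q + M *m w') -> w = w'.
Proof.
move=> MP /complementaryP H /complementaryP H'.
apply/eqP; rewrite -subr_eq0; apply/eqP.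
apply: P_matrix_sign_reversal MP _ => i; rewrite mulmxBr.
have [] := H i; have [] := H' i; rewrite !mxE.
set u := \sum_j _; set u' := \sum_j _; nra.
Qed.

(* [F i = Some true] forces [y i = 0], [F i = Some false] forces [w i = 0],
   where [y = q + M *m w]; the indices with [F i = None] are complementary. *)
Definition partial_lcp (R : realType) (s : nat) (M : 'M[R]_s) (q : 'cV[R]_s)
    (F : 'I_s -> option bool) (w : 'cV[R]_s) : Prop :=
  forall i, match F i with
    | Some true => (q + M *m w) i 0 = 0
    | Some false => w i 0 = 0
    | None => [/\ 0 <= w i 0, 0 <= (q + M *m w) i 0 &
                  w i 0 * (q + M *m w) i 0 = 0]
    end.

Lemma P_matrix_partial_lcp (R : realType) (s : nat) (M : 'M[R]_s)
    (q : 'cV[R]_s) (F : 'I_s -> option bool) :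
  P_matrix M -> exists w, partial_lcp M q F w.
Proof.
move=> MP; have [m] := ubnP #|[set i | F i == None]|.
elim: m F => // m IH F; rewrite ltnS => le_m.
have [k /eqP Fk|allF] := pickP (fun i => F i == None); last first.
  (* With no complementary index left, the conditions form one linear system, whose matrix is a row
     mix with 0-1 weights. *)
  pose a i : R := (F i == Some true)%:R.
  pose b i : R := (F i != Some true)%:R.
  pose G := row_mix M a b.
  have G0 : 0 < \det G.
    apply: P_matrix_det_row_mix => // i; rewrite /a /b; case: eqP => _;
    by rewrite ?ler01 ?addr0 ?add0r ?ltr01.
  have Gu : G \in unitmx by rewrite unitmxE unitfE gt_eqF.
  pose w := invmx G *m - \col_i (a i * q i 0).
  exists w => i.
  have : (G *m w) i 0 = - (a i * q i 0) by rewrite /w mulKVmx // !mxE.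
  rewrite row_mix_mul /a /b; have := allF i.
  case: (F i) => [[]|//] _; rewrite /= ?mul0r ?mul1r ?add0r ?oppr0 //.
  by rewrite addr0 [in X in _ -> X]mxE => ->; rewrite subrr.
pose upd (v : bool) i := if i == k then Some v else F i.
have less v : (#|[set i | upd v i == None]| < m)%N.
  apply: leq_trans le_m; apply: proper_card; apply/properP; split.
    by apply/fintype.subsetP => i; rewrite !inE /upd; case: (i =P k).
  by exists k; rewrite !inE /upd ?Fk // eqxx.
have [w Hw] := IH _ (less false); have [w' Hw'] := IH _ (less true).
have wk : w k 0 = 0 by have := Hw k; rewrite /upd eqxx.
have wk' : (q + M *m w') k 0 = 0 by have := Hw' k; rewrite /upd eqxx.
have [yk|yk] := leP 0 ((q + M *m w) k 0).
  exists w => i; have := Hw i; rewrite /upd; case: (i =P k) => [->|//] _.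
  by rewrite Fk wk mul0r.
exists w' => i; have := Hw' i; rewrite /upd; case: (i =P k) => [->|//] _.
rewrite Fk wk' mulr0; split=> //.
rewrite leNgt; apply/negP => w'k.
(* If [w' k 0 < 0], then [d = w' - w] satisfies [d j 0 * (M *m d) j 0 <= 0] everywhere: at [k] by
   the assumed signs, at forced indices because a factor vanishes, elsewhere by complementarity. *)
suff : w' - w = 0.
  by move=> /colP /(_ k); rewrite !mxE wk subr0 => e; rewrite e ltxx in w'k.
apply: P_matrix_sign_reversal MP _ => j; rewrite mulmxBr.
have [->|jk] := eqVneq j k.
  move: wk wk' yk w'k; rewrite !mxE.
  set u := \sum_j _; set u' := \sum_j _; nra.
have := Hw j; have := Hw' j; rewrite /upd (negPf jk).
case: (F j) => [[]|]; rewrite !mxE;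
  set u := \sum_j _; set u' := \sum_j _.
- by move=> e e'; have -> : u - u' = 0; [lra|rewrite mulr0].
- by move=> -> ->; rewrite subrr mul0r.
- by move=> [? ? ?] [? ? ?]; nra.
Qed.

Lemma P_matrix_is_Q (R : realType) (s : nat) (M : 'M[R]_s) :
  P_matrix M -> Q_matrix M.
Proof.
move=> MP q; have [w Hw] := P_matrix_partial_lcp q (fun=> None) MP.
by exists w; apply/complementaryP => i; exact: Hw i.
Qed.

(** * Reduction of [f x = 0] to a linear complementarity problem *)

Lemma strictly_lower_unitmx (R : realType) (s : nat) (L : 'M[R]_s) :
  strictly_lower_triangular L -> 1%:M - L \in unitmx.
Proof.
move=> Llow; rewrite unitmxE det_trig.
  rewrite big1 ?unitr1 // => i _.
  by rewrite !mxE eqxx Llow // subr0.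
apply/is_trig_mxP => i j ij; rewrite !mxE Llow ?(ltnW ij) // subr0.
by rewrite -val_eqE /= ltn_eqF.
Qed.

Definition lcp_vec (R : realType) (n s : nat) (c : 'cV[R]_s) (b : 'cV[R]_n)
    (Z : 'M[R]_(s, n)) (L : 'M[R]_s) (J : 'M[R]_n) (Y : 'M[R]_(n, s)) :
    'cV[R]_s :=
  let c' := invmx (1%:M - L) *m c in
  c' - tildeZ L Z *m invmx (tildeJ Z L J Y) *m (b + Y *m c').

(** The point [x] obtained by solving [f x = 0] through [tildeJ], once the negative part [w] of the
    switching vector is known. *)
Definition lcp_sol (R : realType) (n s : nat) (c : 'cV[R]_s) (b : 'cV[R]_n)
    (Z : 'M[R]_(s, n)) (L : 'M[R]_s) (J : 'M[R]_n) (Y : 'M[R]_(n, s))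
    (w : 'cV[R]_s) : 'cV[R]_n :=
  - (invmx (tildeJ Z L J Y) *m
     (b + Y *m (invmx (1%:M - L) *m c) + tildeY L Y *m w)).

Section AbsNormalForm.
Variables (R : realType) (n s : nat) (c : 'cV[R]_s) (b : 'cV[R]_n).
Variables (Z : 'M[R]_(s, n)) (L : 'M[R]_s) (J : 'M[R]_n) (Y : 'M[R]_(n, s)).
Hypothesis Llow : strictly_lower_triangular L.
Hypothesis Jt : tildeJ Z L J Y \in unitmx.

Let q := lcp_vec c b Z L J Y.
Let c' := invmx (1%:M - L) *m c.

(** Collecting [u] on the left gives [(1%:M - L) *m u] on one side and [(1%:M + L) *m w] on the
    other; then [1%:M - L] is inverted. *)
Lemma switching_split (x : 'cV[R]_n) (u w : 'cV[R]_s) :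
  u - w = c + Z *m x + L *m (u + w) <->
  u = c' + tildeZ L Z *m x + tildeL L *m w.
Proof.
have Lu := strictly_lower_unitmx Llow.
have -> : c' + tildeZ L Z *m x + tildeL L *m w =
    invmx (1%:M - L) *m (c + Z *m x + (1%:M + L) *m w).
  by rewrite /c' /tildeZ /tildeL -!mulmxA -!mulmxDr.
split=> [H|->].
  rewrite -[LHS](mulKmx Lu); congr (_ *m _); rewrite mulmxBl mulmxDl !mul1mx.
  by rewrite -[X in X - _](subrK w u) H mulmxDr; apply/colP => i; rewrite !mxE;
    ring.
set t := c + Z *m x; set u' := invmx _ *m _.
have H : (1%:M - L) *m u' = t + (1%:M + L) *m w by rewrite mulKVmx.
move: H; rewrite mulmxBl mulmxDl !mul1mx mulmxDr => /colP H.
by apply/colP => i; have := H i; rewrite !mxE; set A := \sum_j _;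
  set B := \sum_j _; move=> ?; lra.
Qed.

Lemma value_split (x : 'cV[R]_n) (u w : 'cV[R]_s) :
  u = c' + tildeZ L Z *m x + tildeL L *m w ->
  b + J *m x + Y *m (u + w) =
  b + Y *m c' + tildeY L Y *m w + tildeJ Z L J Y *m x.
Proof.
move=> ->; rewrite /tildeY /tildeJ !mulmxDr mulmx1 !mulmxDl !mulmxA.
by apply/colP => i; rewrite !mxE; ring.
Qed.

Lemma lcp_sol_eq (x : 'cV[R]_n) (w : 'cV[R]_s) :
  b + Y *m c' + tildeY L Y *m w + tildeJ Z L J Y *m x = 0 <->
  x = lcp_sol c b Z L J Y w.
Proof.
rewrite /lcp_sol -/c'; split=> [/eqP|->]; last first.
  by rewrite mulmxN mulKVmx // subrr.
rewrite addr_eq0 => /eqP ->.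
by rewrite mulmxN mulKmx // opprK.
Qed.

Lemma lcp_slack (w : 'cV[R]_s) :
  q + checkS Z L J Y *m w =
  c' + tildeZ L Z *m lcp_sol c b Z L J Y w + tildeL L *m w.
Proof.
rewrite /q /lcp_vec /checkS /lcp_sol -/c' mulmxBl mulmxN !mulmxDr !mulmxA.
by apply/colP => i; rewrite !mxE; ring.
Qed.

Variable f : 'cV[R]_n -> 'cV[R]_n.
Hypothesis fE :
  forall x z, switching_eq c Z L x z -> f x = b + J *m x + Y *m abs_vec z.

Lemma zero_of_lcp (w : 'cV[R]_s) :
  complementary w (q + checkS Z L J Y *m w) -> f (lcp_sol c b Z L J Y w) = 0.
Proof.
set u := q + _; set x := lcp_sol _ _ _ _ _ _ _ => /complementaryP wu.
have uE : u = c' + tildeZ L Z *m x + tildeL L *m w by exact: lcp_slack.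
(* At each index one of the nonnegative entries of [u] and [w] is zero. *)
have absE : abs_vec (u - w) = u + w.
  apply/colP => i; have [w0 u0 /eqP] := wu i.
  rewrite mulf_eq0 [LHS]mxE [(u - w) i 0]mxE [(- w) i 0]mxE [RHS]mxE.
  case/orP=> /eqP ->.
    by rewrite subr0 addr0 ger0_norm.
  by rewrite !add0r normrN ger0_norm.
have sw : switching_eq c Z L x (u - w).
  by rewrite /switching_eq absE; apply/switching_split.
by rewrite (fE sw) absE (value_split uE); apply/lcp_sol_eq.
Qed.

(** Every zero of [f] comes from a solution [w], so uniqueness of [w] carries over to [x]. *)
Lemma lcp_of_zero (x : 'cV[R]_n) : f x = 0 ->
  exists2 w, complementary w (q + checkS Z L J Y *m w) &
             x = lcp_sol c b Z L J Y w.
Proof.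
move=> fx; have [z [sw _]] := switching_vec_unique c Z x Llow.
pose u : 'cV[R]_s := 2^-1 *: (abs_vec z + z).
pose w : 'cV[R]_s := 2^-1 *: (abs_vec z - z).
have zE : z = u - w by apply/colP => i; rewrite !mxE; field.
have absE : abs_vec z = u + w by apply/colP => i; rewrite !mxE; field.
have uE : u = c' + tildeZ L Z *m x + tildeL L *m w.
  by apply/switching_split; rewrite -absE -zE.
have xE : x = lcp_sol c b Z L J Y w.
  by apply/lcp_sol_eq; rewrite -(value_split uE) -absE -(fE sw).
exists w => //; rewrite lcp_slack -xE -uE; apply/complementaryP => i.
by rewrite !mxE; case: (ger0P (z i 0)) => z0; split; nra.
Qed.

End AbsNormalForm.

Unset Implicit Arguments.
Set Strict Implicit.

Theorem corollary3p1 (R : realType) (n s : nat) (f : 'cV[R]_n -> 'cV[R]_n)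
    (c : 'cV[R]_s) (b : 'cV[R]_n) (Z : 'M[R]_(s, n)) (L : 'M[R]_s)
    (J : 'M[R]_n) (Y : 'M[R]_(n, s))
    (f_pa : piecewise_affine f)
    (f_anf : abs_normal_form f c b Z L J Y)
    (Jt_nonsing : tildeJ Z L J Y \in unitmx) :
  (Q_matrix (checkS Z L J Y) -> exists x : 'cV[R]_n, f x = 0) /\
  (P_matrix (checkS Z L J Y) -> exists! x : 'cV[R]_n, f x = 0).
Proof.
have [Llow fE] := f_anf.
have Qsol : Q_matrix (checkS Z L J Y) -> exists x : 'cV[R]_n, f x = 0.
  move=> /(_ (lcp_vec c b Z L J Y)) [w Hw].
  by exists (lcp_sol c b Z L J Y w); exact: zero_of_lcp Hw.
split=> // SP; have [x fx] := Qsol (P_matrix_is_Q SP).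
exists x; split=> // x' fx'.
have [w Hw ->] := lcp_of_zero Llow Jt_nonsing fE fx.
have [w' Hw' ->] := lcp_of_zero Llow Jt_nonsing fE fx'.
by rewrite (P_matrix_lcp_unique SP Hw Hw').
Qed.
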